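(* Let $E$ be a finite set, let $V$ be a linear subspace of $\mathrm{GF}(2)^E$, let $M:=M(V)$ with rank function $r$, and let $\iota$ denote the imaginary unit. If $q_V(x)=0$ for all $x\in V\cap V^\perp$, then $$T_M(-\iota,\iota)= e^{\frac{\pi \iota}{4}(\sigma(\tilde{q}_V)+|E|-3r(E))}\sqrt{2}^{\,d(V)},$$ and otherwise $T_M(-\iota,\iota)=0$.
   Context: For $v\in\mathrm{GF}(2)^E$, $\mathrm{supp}(v)=\{e\in E: v_e\neq 0\}$. For a subspace $V\subseteq \mathrm{GF}(2)^E$, $M(V)$ is the matroid on $E$ whose independent sets are the sets $F\subseteq E$ such that there is no nonzero $v\in V$ with $\mathrm{supp}(v)\subseteq F$ (so $r(E)=|E|-\dim V$). The Tutte polynomial of a matroid $M$ on $E$ with rank function $r$ is $T_M(x,y)=\sum_{F\subseteq E}(x-1)^{r(E)-r(F)}(y-1)^{|F|-r(F)}$. Let $b(x,y)=\sum_{e\in E}x_ey_e\in\mathrm{GF}(2)$, $V^\perp=\{w: b(w,v)=0\ \forall v\in V\}$, and the bicycle dimension $d(V):=\dim(V\cap V^\perp)$. Define $q_V:V\to\mathbb{Z}/4\mathbb{Z}$ by $q_V(x)=|\mathrm{supp}(x)| \bmod 4$. If $q_V$ vanishes on $V\cap V^\perp$, then $q_V(x+y)=q_V(x)$ for $x\in V$, $y\in V\cap V^\perp$, and $\tilde q_V: V/(V\cap V^\perp)\to\mathbb{Z}/4\mathbb{Z}$ is defined by $\tilde q_V(x+V\cap V^\perp)=q_V(x)$; it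 satisfies $\tilde q(x+y)=\tilde q(x)+\tilde q(y)+\alpha(\tilde b(x,y))$ with $\tilde b$ the nondegenerate bilinear form induced by $b$ and $\alpha:\mathrm{GF}(2)\to\mathbb{Z}/4\mathbb{Z}$, $\alpha(0)=0,\alpha(1)=2$. For such a nonsingular $\mathbb{Z}/4\mathbb{Z}$-valued quadratic form $q$ on a $\mathrm{GF}(2)$-space $W$, Brown's invariant $\sigma(q)\in\mathbb{Z}/8\mathbb{Z}$ is defined by $\sum_{x\in W}\iota^{q(x)}=\sqrt{2}^{\dim W}e^{\pi\iota\sigma(q)/4}$. *)

(* Defs.v *)
From HB Require Import structures.
From mathcomp Require Import all_boot all_order all_algebra all_field.
From mathcomp Require Import complex.
From mathcomp Require Import reals sequences exp trigo.

Set Implicit Arguments.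
Unset Strict Implicit.
Unset Printing Implicit Defensive.

Import Order.TTheory GRing.Theory Num.Theory.
Local Open Scope ring_scope.

Record matroid (E : finType) := Matroid {
  indep : {set {set E}};
  indep0 : set0 \in indep;
  indepS : forall I J : {set E}, I \subset J -> J \in indep -> I \in indep;
  indep_aug : forall I J : {set E}, I \in indep -> J \in indep ->
    (#|I| < #|J|)%N -> exists2 e, e \in J :\: I & e |: I \in indep }.

Definition rank (E : finType) (M : matroid E) (F : {set E}) : nat :=
  \max_(I in indep M | I \subset F) #|I|.

(* The exponents are truncated differences in [nat]; no truncation occurs,
   since rank F <= rank setT and rank F <= #|F|. *)
Definition tutte (E : finType) (M : matroid E) (K : comNzRingType) (x y : K) : K :=
  \sum_(F : {set E})
    (x - 1) ^+ (rank M [set: E] - rank M F) * (y - 1) ^+ (#|F| - rank M F).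

(* [^o] is only there to make GF(2) a vector space over itself. *)
Notation GF2 E := {ffun E -> ('F_2)^o}.

Definition supp (E : finType) (v : GF2 E) : {set E} := [set e | v e != 0].

Definition code_indep (E : finType) (V : {vspace GF2 E}) : {set {set E}} :=
  [set F : {set E} | ~~ [exists v, [&& v \in V, v != 0 & supp v \subset F]]].

Section CodeMatroid.
Variables (E : finType) (V : {vspace GF2 E}).

Lemma code_indepP (F : {set E}) :
  reflect (forall v, v \in V -> supp v \subset F -> v = 0) (F \in code_indep V).
Proof.
rewrite inE; apply: (iffP idP) => [/existsPn H v vV vF|H].
  by have := H v; rewrite vV vF andbT /= negbK => /eqP.
by apply/existsPn => v; apply/and3P => -[vV v0 vF]; rewrite (H v) ?eqxx in v0.
Qed.

Lemma supp_out (F : {set E}) (v : GF2 E) e : supp v \subset F -> e \notin F -> v e = 0.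
Proof. by move=> /subsetP vF; apply: contraNeq => ve; apply: vF; rewrite inE. Qed.

Lemma code_indep0 : set0 \in code_indep V.
Proof.
apply/code_indepP => v _ v0; apply/ffunP => e; rewrite ffunE.
by apply: supp_out v0 _; rewrite inE.
Qed.

Lemma code_indepS (I J : {set E}) :
  I \subset J -> J \in code_indep V -> I \in code_indep V.
Proof.
move=> IJ /code_indepP HJ; apply/code_indepP => v vV vI.
by apply: HJ => //; apply: subset_trans IJ.
Qed.

Lemma F2_neq0 (a b : 'F_2) : a != 0 -> b != 0 -> a = b.
Proof. by case: a b => [[|[|a]] ?] [[|[|b]] ?] // _ _; apply: val_inj. Qed.

Lemma code_indep_aug (I J : {set E}) : I \in code_indep V -> J \in code_indep V ->
  (#|I| < #|J|)%N -> exists2 e, e \in J :\: I & e |: I \in code_indep V.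
Proof.
move=> iI iJ ltIJ; case: (pickP [pred e | (e \in J :\: I) && (e |: I \in code_indep V)]).
  by move=> e /= /andP[]; exists e.
move=> none; exfalso.
have /code_indepP HI := iI; have /code_indepP HJ := iJ.
have ex e : e \in J :\: I -> exists v : GF2 E,
    [&& v \in V, v e != 0 & supp v \subset e |: I].
  move=> eJI; have := none e; rewrite /= eJI /= inE => /negbFE/existsP[v].
  case/and3P=> vV v0 vF; exists v; rewrite vV vF andbT /=.
  apply: contraNneq v0 => ve; apply/eqP/HI => //; apply/subsetP => f fv.
  have := subsetP vF f fv; rewrite in_setU1 => /orP[/eqP fe|//].
  by move: fv; rewrite fe inE ve eqxx.
pose w e : GF2 E := odflt 0 [pick v : GF2 E | [&& v \in V, v e != 0 & supp v \subset e |: I]].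
have wP e : e \in J :\: I -> [&& w e \in V, w e e != 0 & supp (w e) \subset e |: I].
  move=> /ex[v vP]; rewrite /w; case: pickP => [u //|/(_ v)]; last by rewrite vP.
pose comb (A : {set E}) : GF2 E := \sum_(e in A) w e.
pose ph (A : {set E}) : {set E} := supp (comb A) :&: (I :\: J).
have combV (A : {set E}) : A \subset J :\: I -> comb A \in V.
  by move=> AJ; apply: rpred_sum => e eA; case/and3P: (wP e (subsetP AJ e eA)).
have combE (A : {set E}) f : A \subset J :\: I -> f \in J :\: I ->
    (comb A f != 0) = (f \in A).
  move=> AJ fJI; rewrite /comb sum_ffunE.
  have fI : f \notin I by case/setDP: fJI.
  have out e : e \in A -> e != f -> w e f = 0.
    move=> eA ef; case/and3P: (wP e (subsetP AJ e eA)) => _ _ se.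
    by apply: supp_out se _; rewrite in_setU1 negb_or eq_sym ef.
  case: (boolP (f \in A)) => fA.
    rewrite (bigD1 f) //= big1 ?addr0; first by case/and3P: (wP f fJI).
    by move=> e /andP[]; apply: out.
  rewrite big1 ?eqxx // => e eA; apply: out => //.
  by apply: contraNneq fA => <-.
have combS (A : {set E}) : A \subset J :\: I -> supp (comb A) \subset I :|: J.
  move=> AJ; apply/subsetP => f; rewrite inE; apply: contraR => fIJ.
  rewrite sum_ffunE big1 // => e eA.
  have eJI := subsetP AJ e eA; case/and3P: (wP e eJI) => _ _ se.
  apply: supp_out se _; move: fIJ; rewrite !inE !negb_or => /andP[-> fJ].
  by rewrite andbT; apply: contraNneq fJ => ->; case/setDP: eJI.
have inj : {in powerset (J :\: I) &, injective ph}.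
  move=> A B; rewrite !powersetE => AJ BJ eqph.
  have d0 : comb A - comb B = 0.
    apply: HJ; first by rewrite rpredB ?combV.
    apply/subsetP => f; rewrite inE !ffunE; apply: contraR => fJ.
    case: (boolP (f \in I)) => fI; last first.
      have out (C : {set E}) : C \subset J :\: I -> comb C f = 0.
        by move=> CJ; apply: supp_out (combS C CJ) _; rewrite inE negb_or fI.
      by rewrite !out ?subrr.
    have := congr1 (fun S : {set E} => f \in S) eqph.
    rewrite !inE fI fJ /= !andbT subr_eq0 => eqAB; apply/eqP.
    have [a0|a0] := boolP (comb A f == 0); move: eqAB; rewrite ?a0 ?(negPf a0) /=.
      by move/esym/negbFE/eqP => ->; apply/eqP.
    by move/esym=> b0; apply: F2_neq0.
  apply/setP => f; case: (boolP (f \in J :\: I)) => fJI.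
    by rewrite -(combE A f) // -(combE B f) //; move/eqP: d0; rewrite subr_eq0 => /eqP->.
  have out (C : {set E}) : C \subset J :\: I -> (f \in C) = false.
    by move=> /subsetP CJ; apply: contraNF fJI; apply: CJ.
  by rewrite !out.
have : (#|ph @: powerset (J :\: I)| <= #|powerset (I :\: J)|)%N.
  apply: subset_leq_card; apply/subsetP => _ /imsetP[A _ ->].
  by rewrite powersetE subsetIr.
rewrite card_in_imset // !card_powerset leq_exp2l // leqNgt; apply/negP.
by rewrite negbK -(ltn_add2l #|I :&: J|) cardsID setIC cardsID.
Qed.

End CodeMatroid.

Definition code_matroid (E : finType) (V : {vspace GF2 E}) : matroid E :=
  Matroid (code_indep0 V) (@code_indepS E V) (@code_indep_aug E V).

Section Perp.
Variable E : finType.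

Definition dot (x y : GF2 E) : ('F_2)^o := \sum_e x e * y e.

Lemma dot_is_linear x : linear (dot x).
Proof.
move=> a y z; rewrite /dot scaler_sumr -big_split /=; apply: eq_bigr => e _.
by rewrite !ffunE mulrDr; congr (_ + _); rewrite /GRing.scale /= mulrCA.
Qed.
HB.instance Definition _ x :=
  GRing.isLinear.Build 'F_2 (GF2 E) ('F_2)^o _ (dot x) (dot_is_linear x).

Definition perp (V : {vspace GF2 E}) : {vspace GF2 E} :=
  (\bigcap_(v : GF2 E | v \in V) lker (linfun (dot v)))%VS.

Lemma dotC x y : dot x y = dot y x.
Proof. by apply: eq_bigr => e _; rewrite mulrC. Qed.

Lemma mem_perp (V : {vspace GF2 E}) w : reflect (forall v, v \in V -> dot w v = 0) (w \in perp V).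
Proof.
apply: (iffP idP) => [/subv_bigcapP H v vV|H].
  by have := H v vV; rewrite -memvE memv_ker lfunE /= dotC => /eqP.
by apply/subv_bigcapP => v vV; rewrite -memvE memv_ker lfunE /= dotC H.
Qed.

Definition bicycle (V : {vspace GF2 E}) : {vspace GF2 E} := (V :&: perp V)%VS.

Definition bicycle_dim (V : {vspace GF2 E}) : nat := \dim (bicycle V).

End Perp.

Definition vquot (K : fieldType) (vT : vectType K) (U : {vspace vT}) : Type :=
  Quotient.quot (pred_of_vspace U).

Section VQuot.
Variables (K : fieldType) (vT : vectType K) (U : {vspace vT}).
Local Notation Q := (vquot U).
Local Open Scope quotient_scope.

HB.instance Definition _ := GRing.Zmodule.on Q.
HB.instance Definition _ := Quotient.on Q.

Definition vpi (x : vT) : Q := \pi_(Quotient.quot (pred_of_vspace U)) x.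

Lemma vpiD : {morph vpi : x y / x + y}.
Proof. by move=> x y; rewrite /vpi Quotient.pi_add. Qed.

Lemma vpi_eq x y : (vpi x == vpi y) = (x - y \in U).
Proof. by rewrite Quotient.idealrBE. Qed.

Lemma vpiK (w : Q) : vpi (repr w) = w.
Proof. exact: reprK. Qed.

Lemma repr_vpi x : repr (vpi x) - x \in U.
Proof. by rewrite -vpi_eq vpiK. Qed.

Definition vquot_scale (a : K) (w : Q) : Q := vpi (a *: repr w).

Lemma vquot_scale_pi a x : vquot_scale a (vpi x) = vpi (a *: x).
Proof. by apply/eqP; rewrite vpi_eq -scalerBr memvZ // repr_vpi. Qed.

Lemma vquot_scalerA a b w : vquot_scale a (vquot_scale b w) = vquot_scale (a * b) w.
Proof. by rewrite -[w]vpiK !vquot_scale_pi scalerA. Qed.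
Lemma vquot_scale1r : left_id 1 vquot_scale.
Proof. by move=> w; rewrite -[w]vpiK vquot_scale_pi scale1r. Qed.
Lemma vquot_scalerDr : right_distributive vquot_scale +%R.
Proof.
by move=> a w z; rewrite -[w]vpiK -[z]vpiK -vpiD !vquot_scale_pi scalerDr vpiD.
Qed.
Lemma vquot_scalerDl w : {morph vquot_scale^~ w : a b / a + b}.
Proof. by move=> a b; rewrite -[w]vpiK !vquot_scale_pi scalerDl vpiD. Qed.

HB.instance Definition _ := GRing.Zmodule_isLmodule.Build K Q
  vquot_scalerA vquot_scale1r vquot_scalerDr vquot_scalerDl.

Lemma vquot_scaleE (a : K) (w : Q) : a *: w = vquot_scale a w.
Proof. by []. Qed.

Lemma vpi_is_linear : linear vpi.
Proof. by move=> a x y; rewrite vpiD -vquot_scale_pi. Qed.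
HB.instance Definition _ := GRing.isLinear.Build K vT Q _ vpi vpi_is_linear.

Fact vquot_vect_iso : Vector.axiom (\dim U^C) Q.
Proof.
pose c (x : vT) := x - projv U x.
have c0 x : x \in U -> c x = 0 by move=> xU; rewrite /c projv_id ?subrr.
have cL a x y : c (a *: x + y) = a *: c x + c y.
  by rewrite /c linearP scalerBr opprD addrACA.
pose g (x : vT) := \row_i coord (vbasis U^C) i (c x).
pose f (w : Q) := g (repr w).
have fpi x : f (vpi x) = g x.
  rewrite /f -[repr _](subrK x) -[_ - x]scale1r; apply/rowP => i.
  by rewrite !mxE cL scale1r c0 ?add0r ?repr_vpi.
exists f.
  move=> a w z; rewrite -[w]vpiK -[z]vpiK vquot_scaleE vquot_scale_pi -vpiD !fpi.
  by apply/rowP => i; rewrite !mxE cL linearP.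
exists (fun r : 'rV_(\dim U^C) => vpi (\sum_i r 0 i *: (vbasis U^C)`_i)) => [w|r].
  under eq_bigr do rewrite mxE.
  rewrite -coord_vbasis ?memv_projC // -{2}[w]vpiK; apply/eqP.
  by rewrite vpi_eq /c addrAC subrr sub0r rpredN memv_proj.
rewrite fpi /g; set u := \sum_i _.
have uC : u \in (U^C)%VS.
  by apply: rpred_sum => j _; rewrite rpredZ ?vbasis_mem ?memt_nth.
have -> : c u = u.
  by move: uC; rewrite /c -lker_proj memv_ker => /eqP->; rewrite subr0.
by apply/rowP=> i; rewrite mxE coord_sum_free ?(basis_free (vbasisP _)).
Qed.

HB.instance Definition _ := Lmodule_hasFinDim.Build K Q vquot_vect_iso.

End VQuot.

Definition code_form (E : finType) (V : {vspace GF2 E}) (x : subvs_of V) : 'Z_4 :=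
  #|supp (vsval x)|%:R.

Definition bicycle_in (E : finType) (V : {vspace GF2 E}) : {vspace subvs_of V} :=
  (linfun vsval @^-1: bicycle V)%VS.

(* The form is evaluated at the canonical representative of a coset; by
   [red_formE] below it does not depend on the representative as soon as
   [code_form V] vanishes on [bicycle V]. *)
Definition red_form (E : finType) (V : {vspace GF2 E}) (w : vquot (bicycle_in V)) :
  'Z_4 := code_form (repr w).

Arguments red_form {E} V w.

Section RedForm.
Variables (E : finType) (V : {vspace GF2 E}).

Lemma mem_bicycle_in (x : subvs_of V) : (x \in bicycle_in V) = (vsval x \in bicycle V).
Proof. by rewrite -memv_preim lfunE. Qed.

Lemma F2_val (a : 'F_2) : a = (a != 0)%:R.
Proof. by case: a => [[|[|a]] ?] //; apply: val_inj. Qed.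

Lemma card_suppD (x y : GF2 E) :
  (#|supp (x + y)%R| + (#|supp x :&: supp y|).*2 = #|supp x| + #|supp y|)%N.
Proof.
have -> : supp (x + y) = (supp x :\: supp y) :|: (supp y :\: supp x).
  apply/setP => e; rewrite !inE !ffunE (F2_val (x e)) (F2_val (y e)).
  by case: (x e != 0); case: (y e != 0).
rewrite cardsU [_ :&: _](_ : _ = set0) ?cards0 ?subn0; last first.
  by apply/setP => e; rewrite !inE; case: (x e == 0); case: (y e == 0).
rewrite -(cardsID (supp y) (supp x)) -(cardsID (supp x) (supp y)).
by rewrite [supp y :&: _]setIC [RHS]addnACA addnn addnC.
Qed.

Lemma dot_card (x y : GF2 E) : dot x y = #|supp x :&: supp y|%:R.
Proof.
rewrite /dot -sum1_card natr_sum [RHS]big_mkcond /=; apply: eq_bigr => e _.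
rewrite !inE (F2_val (x e)) (F2_val (y e)).
by case: (x e != 0); case: (y e != 0); apply: val_inj.
Qed.

Lemma code_formD (x y : subvs_of V) :
  code_form (x + y) =
  code_form x + code_form y + (dot (vsval x) (vsval y) != 0)%:R *+ 2.
Proof.
rewrite /code_form raddfD /= dot_card.
have Z4 (a : 'Z_4) : a *+ 2 *+ 2 = 0.
  by rewrite -mulrnA -mulr_natr [4%:R](_ : _ = 0) ?mulr0 //; apply: val_inj.
set k := #|supp (vsval x) :&: supp (vsval y)|.
have kE : (k%:R : 'Z_4) *+ 2 = ((k%:R : ('F_2)^o) != 0)%:R *+ 2.
  have -> : ((k%:R : ('F_2)^o) != 0) = odd k.
    rewrite -[_%:R]/((k%:R : 'F_2)) -(inj_eq val_inj) /= val_Fp_nat // modn2.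
    by case: (odd k).
  by rewrite -{1}(odd_double_half k) natrD mulrnDl -muln2 natrM mulr_natr Z4 addr0.
have := congr1 (fun n => n%:R : 'Z_4) (card_suppD (vsval x) (vsval y)).
rewrite /= -/k !natrD -muln2 natrM mulr_natr kE => <-.
by rewrite -addrA -mulr2n Z4 addr0.
Qed.

Lemma red_formE (x : subvs_of V) :
  (forall y : subvs_of V, vsval y \in bicycle V -> code_form y = 0) ->
  red_form V (vpi (bicycle_in V) x) = code_form x.
Proof.
move=> q0; rewrite /red_form; set z := repr _.
have zx : vsval (z - x) \in bicycle V by rewrite -mem_bicycle_in repr_vpi.
rewrite -[z](subrK x) code_formD q0 // add0r.
have [_ /mem_perp ->] := memv_capP zx; last exact: subvsP.
by rewrite eqxx mul0rn addr0.
Qed.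

End RedForm.

Section Brown.
Variable R : realType.
Local Open Scope complex_scope.

Definition cexp (z : R[i]) : R[i] :=
  let: a +i* b := z in (expR a)%:C * (cos b +i* sin b).

(* [finvect_type W] is [W] with its structure of finite type. *)
Definition gauss_sum (W : vectType 'F_2) (q : W -> 'Z_4) : R[i] :=
  \sum_(x : finvect_type W) 'i%C ^+ (q x : nat).

(* The condition does not depend on the lift of s from Z/8 to nat, and
   determines s.  Such an s exists for every nonsingular quadratic form q;
   the default 0 is junk, for functions q with no such s. *)
Definition brown (W : vectType 'F_2) (q : W -> 'Z_4) : 'Z_8 :=
  odflt 0 [pick s : 'Z_8 | gauss_sum q ==
    (Num.sqrt 2)%:C ^+ \dim {:W} * cexp (pi%:C * 'i%C * (s : nat)%:R / 4)].

End Brown.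

(* Main.v *)
Require Import Defs.
From mathcomp Require Import all_boot all_order all_algebra all_field.
From mathcomp Require Import complex.
From mathcomp Require Import reals sequences exp trigo.
From mathcomp Require Import ring lra zify.

Set Implicit Arguments.
Unset Strict Implicit.
Unset Printing Implicit Defensive.

Import Order.TTheory GRing.Theory Num.Theory.
Local Open Scope ring_scope.
Local Open Scope complex_scope.

(** The number of words of [V] supported in [F] is [2 ^ (|F| - r(F))], so at
    [(x - 1)(y - 1) = 2] the Tutte polynomial is, up to an explicit factor, the
    weight enumerator [S = sum_(v in V) x ^ - |v|]; here [x ^-1 = i].
    Translation by a word [y] of the bicycle space [B] multiplies [S] by
    [i ^ |y|], so [S = 0] unless the form vanishes on [B].  If it does, then
    [S = 2 ^ d G] with [G] the Gauss sum on [V / B], and orthogonality of the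
    signs [(-1) ^ b(u, v)] gives [S S^* = |V| |B|].  Hence [G] is a Gaussian
    integer of norm [2 ^ dim (V / B)], that is, [i ^ k (1 + i) ^ dim (V / B)]:
    this is why Brown's invariant exists. *)

(** * Rank function of a matroid *)

Lemma rank_witness (E : finType) (M : matroid E) (F : {set E}) :
  exists2 I : {set E}, (I \in indep M) && (I \subset F) & rank M F = #|I|.
Proof.
rewrite /rank.
have : (0 < #|[pred I : {set E} | (I \in indep M) && (I \subset F)]|)%N.
  by apply/card_gt0P; exists set0; rewrite inE indep0 sub0set.
by case/(@eq_bigmax_cond _ _ (fun I : {set E} => #|I|)) => I PI ->; exists I.
Qed.

Lemma leq_rank (E : finType) (M : matroid E) (F I : {set E}) :
  I \in indep M -> I \subset F -> (#|I| <= rank M F)%N.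
Proof.
move=> iI sI; rewrite /rank.
by apply: (@leq_bigmax_cond _ _ (fun I : {set E} => #|I|)); rewrite iI.
Qed.

Lemma rank_leq_card (E : finType) (M : matroid E) (F : {set E}) :
  (rank M F <= #|F|)%N.
Proof. by have [I /andP[_ /subset_leq_card sI] ->] := rank_witness M F. Qed.

Lemma rankS (E : finType) (M : matroid E) (F G : {set E}) :
  F \subset G -> (rank M F <= rank M G)%N.
Proof.
move=> FG; have [I /andP[iI sI] ->] := rank_witness M F.
by apply: leq_rank => //; apply: subset_trans FG.
Qed.

(** * Words supported in a set, and the Tutte polynomial as a weight enumerator *)

Section Code.
Variables (E : finType) (V : {vspace GF2 E}).
Implicit Types (u v w : GF2 E) (F : {set E}).
Local Notation M := (code_matroid V).

(* For a basis [I] of [F], the words supported in [F] are determined by, and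
   can be prescribed arbitrarily on, [F :\: I]. *)
Lemma card_subcode F :
  #|[set v in V | supp v \subset F]| = (2 ^ (#|F| - rank M F))%N.
Proof.
have [I /andP[iI sI] rI] := rank_witness M F.
have /code_indepP HI : I \in code_indep V by [].
have -> : (#|F| - rank M F)%N = #|F :\: I| by rewrite rI cardsD (setIidPr sI).
have ex e : e \in F :\: I ->
    exists v, [&& v \in V, v e != 0 & supp v \subset e |: I].
  case/setDP=> eF eI.
  (* [I] has maximum size among the independent subsets of [F], so [e |: I] supports a nonzero word;
     independence of [I] keeps that word from vanishing at [e]. *)
  have : e |: I \notin code_indep V.
    apply/negP => /(@leq_rank _ M F) /(_ _).
    by rewrite subUset sub1set eF sI rI cardsU1 eI ltnn => /(_ isT).
  rewrite inE negbK => /existsP[v /and3P[vV v0 vF]]; exists v; rewrite vV vF andbT /=.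
  apply: contraNneq v0 => ve; apply/eqP/HI => //; apply/subsetP => f fv.
  have := subsetP vF f fv; rewrite in_setU1 => /orP[/eqP fe|//].
  by move: fv; rewrite fe inE ve eqxx.
pose w e : GF2 E :=
  odflt 0 [pick v : GF2 E | [&& v \in V, v e != 0 & supp v \subset e |: I]].
have wP e : e \in F :\: I -> [&& w e \in V, w e e != 0 & supp (w e) \subset e |: I].
  move=> /ex[v vP]; rewrite /w; case: pickP => [u //|/(_ v)]; last by rewrite vP.
rewrite -card_powerset.
rewrite -(@card_in_imset _ _ (fun v => supp v :&: (F :\: I))); last first.
  move=> u v; rewrite !inE => /andP[uV uF] /andP[vV vF] eq_uv.
  apply/eqP; rewrite -subr_eq0; apply/eqP/HI; first by rewrite rpredB.
  apply/subsetP => f; rewrite inE !ffunE; apply: contraR => fI.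
  case: (boolP (f \in F)) => fF; last by rewrite !(supp_out _ fF) ?subrr.
  have := congr1 (fun S : {set E} => f \in S) eq_uv.
  rewrite !inE fI fF /= !andbT subr_eq0 => euv; apply/eqP.
  have [/eqP u0|u0] := boolP (u f == 0).
    by move: euv; rewrite u0 eqxx => /esym/negbFE/eqP.
  by apply: F2_neq0 => //; rewrite -euv.
apply: eq_card => A; rewrite powersetE; apply/imsetP/idP => [[v _ ->]|AF].
  exact: subsetIr.
(* On [F :\: I] the word [w e] is nonzero at [e] only, so this sum meets [F :\: I] exactly in
   [A]. *)
exists (\sum_(e in A) w e).
  rewrite inE; apply/andP; split.
    by apply: rpred_sum => e eA; case/and3P: (wP e (subsetP AF e eA)).
  apply/subsetP => f; rewrite inE sum_ffunE; apply: contraR => fF.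
  apply/eqP; apply: big1 => e eA.
  have eFI := subsetP AF e eA; case/and3P: (wP e eFI) => _ _ se.
  apply: supp_out se _; rewrite in_setU1 negb_or (contra (subsetP sI f) fF) andbT.
  by apply: contraNneq fF => ->; case/setDP: eFI.
apply/setP => f; rewrite in_setI inE.
case: (boolP (f \in F :\: I)) => fFI; last first.
  by rewrite andbF; apply: contraNF fFI; apply: (subsetP AF).
rewrite andbT sum_ffunE.
have out e : e \in A -> e != f -> w e f = 0.
  move=> eA ef; case/and3P: (wP e (subsetP AF e eA)) => _ _ se.
  by apply: supp_out se _; rewrite in_setU1 negb_or eq_sym ef; case/setDP: fFI.
case: (boolP (f \in A)) => fA.
  rewrite (bigD1 f) //= big1 ?addr0; first by case/and3P: (wP f fFI) => _ ->.
  by move=> e /andP[]; apply: out.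
rewrite big1 ?eqxx // => e eA; apply: out => //.
by apply: contraNneq fA => <-.
Qed.

Lemma card_code : #|[set v in V]| = (2 ^ (#|E| - rank M [set: E]))%N.
Proof.
rewrite -cardsT -card_subcode; apply: eq_card => v.
by rewrite !inE subsetT andbT.
Qed.

(** Both sides are the product over [e] of [z + (e \notin A)]. In its expansion, [F] collects the
    positions where [z] is chosen, and the other factors kill every [F] that misses a point of
    [A]. *)
Lemma sum_supersets (K : comNzRingType) (z : K) (A : {set E}) :
  \sum_(F : {set E} | A \subset F) z ^+ #|F|
  = z ^+ #|A| * (1 + z) ^+ (#|E| - #|A|).
Proof.
transitivity (\prod_(e : E) (z + (e \notin A)%:R)).
  rewrite bigA_distr big_mkcond /=; apply: eq_bigr => F _.
  case: (boolP (A \subset F)) => [AF|/subsetPn[e eA eF]]; last first.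
    by rewrite (bigD1 e) //= (negPf eF) eA mul0r.
  rewrite -prodr_const [LHS]big_mkcond /=; apply: eq_bigr => e _.
  by case: ifP => // /negbT eF; rewrite (contra (subsetP AF e) eF).
have -> : (#|E| - #|A|)%N = #|~: A| by rewrite -(cardsC A) addKn.
rewrite -!prodr_const (bigID (mem A)) /=; congr (_ * _).
  by apply: eq_bigr => e ->; rewrite addr0.
by apply: eq_big => e; rewrite ?inE // => /negPf->; rewrite addrC.
Qed.

Definition weight_sum (K : nzRingType) (j : K) : K :=
  \sum_(v : GF2 E | v \in V) j ^+ #|supp v|.

(** With [y - 1 = 2 / (x - 1)], the term of [F] is [(x - 1) ^ (r - |F|)] times a power of 2 that
    counts the words supported in [F]. Exchanging the two sums leaves, for each word, a sum over the
    supersets of its support. *)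
Lemma tutte_weight_sum (K : fieldType) (x y : K) :
  (x - 1) * (y - 1) = 2 -> x - 1 != 0 -> x != 0 ->
  tutte M x y = (x - 1) ^+ rank M [set: E] * (x / (x - 1)) ^+ #|E|
                * weight_sum x^-1.
Proof.
move=> xy x1 x0; set r := rank M [set: E].
have term F : (x - 1) ^+ (r - rank M F) * (y - 1) ^+ (#|F| - rank M F)
  = (x - 1) ^+ r * \sum_(v | (v \in V) && (supp v \subset F)) ((x - 1)^-1) ^+ #|F|.
  have c : #|[pred v | (v \in V) && (supp v \subset F)]|
      = (2 ^ (#|F| - rank M F))%N.
    by rewrite -card_subcode; apply: eq_card => v; rewrite !inE.
  rewrite sumr_const c.
  rewrite -mulr_natr natrX -xy exprMn.
  rewrite [(_ - 1) ^+ (r - _)]exprB ?unitfE // ?rankS ?subsetT //.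
  have e : (x - 1) ^+ #|F| = (x - 1) ^+ rank M F * (x - 1) ^+ (#|F| - rank M F).
    by rewrite -exprD subnKC // rank_leq_card.
  rewrite exprVn e invfM -!mulrA; congr (_ * _); congr (_ * _).
  by rewrite mulKf // expf_neq0.
rewrite /tutte (eq_bigr _ (fun F _ => term F)) -mulr_sumr -!mulrA; congr (_ * _).
rewrite (exchange_big_dep (fun v => v \in V)) /=; last by move=> ? ? _ /andP[].
rewrite /weight_sum mulr_sumr; apply: eq_bigr => v vV.
under eq_bigl do rewrite vV /=.
rewrite sum_supersets.
have -> : 1 + (x - 1)^-1 = x / (x - 1).
  by field.
have le : (#|supp v| <= #|E|)%N by rewrite max_card.
rewrite -[in RHS](subnK le) exprD -mulrA mulrC; congr (_ * _).
by rewrite -exprMn mulrAC mulfV // mul1r.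
Qed.

(** * Translation by words, and orthogonality of signs *)

Section Char.
Variables (K : numDomainType) (j : K).
Hypothesis j2 : j ^+ 2 = -1.
Local Notation chi v := (j ^+ #|supp v|).

(** The weight of [u + v] falls short of [|u| + |v|] by twice the overlap; the parity of the overlap
    is [dot u v], and [j ^+ 2 = -1]. *)
Lemma chiD u v : chi (u + v) = chi u * chi v * (-1) ^+ (dot u v != 0 : bool).
Proof.
have -> : (dot u v != 0) = odd #|supp u :&: supp v|.
  rewrite dot_card -[_%:R]/((_%:R : 'F_2)) -(inj_eq val_inj) /= val_Fp_nat // modn2.
  by case: (odd _).
rewrite signr_odd -exprD -card_suppD exprD -mul2n exprM j2 -mulrA -exprD addnn.
by rewrite -mul2n exprM sqrrN expr1n expr1n mulr1.
Qed.

Lemma weight_sum_eq0 v : v \in bicycle V -> chi v != 1 -> weight_sum j = 0.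
Proof.
case/memv_capP => vV /mem_perp vP chi1.
have e : weight_sum j = chi v * weight_sum j.
  rewrite {1}/weight_sum (reindex_inj (addrI v)) /weight_sum mulr_sumr /=.
  apply: eq_big => [u|u uV]; first by rewrite rpredDl.
  by rewrite chiD vP ?eqxx ?mulr1 // -(rpredDl _ vV).
have : (1 - chi v) * weight_sum j = 0 by rewrite mulrBl mul1r -e subrr.
by move/eqP; rewrite mulf_eq0 subr_eq0 eq_sym (negPf chi1) => /eqP.
Qed.

(** If some [v] in [V] has [dot u v != 0], translation by [v] flips every sign, so the sum equals
    its own opposite and vanishes in characteristic 0. *)
Lemma sum_signs u :
  \sum_(v | v \in V) (-1) ^+ (dot u v != 0 : bool) =
  (if u \in perp V then #|[set v in V]|%:R else 0) :> K.
Proof.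
case: ifPn => [/mem_perp uV|uV].
  rewrite (eq_bigr (fun _ => 1)) => [|v vV]; last by rewrite uV ?eqxx.
  by rewrite sumr_const cardsE.
have [v /andP[vV uv]] : exists v, (v \in V) && (dot u v != 0).
  apply/existsP; apply: contraR uV => /existsPn H; apply/mem_perp => v vV.
  by have := H v; rewrite vV /= negbK => /eqP.
set s := \sum_(_ | _) _.
have e : s = - s.
  rewrite {1}/s (reindex_inj (addrI v)) /s -sumrN /=.
  apply: eq_big => [w|w _]; first by rewrite rpredDl.
  rewrite raddfD /=; have := uv; rewrite (F2_val (dot u v)) (F2_val (dot u w)).
  by case: (dot u v != 0) => // _; case: (dot u w != 0); rewrite ?opprK.
have : s *+ 2 == 0 by rewrite mulr2n {2}e subrr.
by rewrite mulrn_eq0 => /eqP.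
Qed.

(** Here [- j] is the inverse of [j] and acts as its conjugate. Replacing [u] by [v + u] in the
    double sum cancels the weight of [v] and leaves a sign; summing over [v] first keeps only the
    [u] in [perp V]. *)
Lemma weight_sum_conj :
  weight_sum j * weight_sum (- j) =
  #|[set v in V]|%:R * \sum_(v | v \in bicycle V) chi v.
Proof.
have cc n : (- j) ^+ n * j ^+ n = 1.
  by rewrite -exprMn mulNr -expr2 j2 opprK expr1n.
transitivity (\sum_(v | v \in V) \sum_(u | u \in V)
    chi u * (-1) ^+ (dot u v != 0 : bool)).
  rewrite mulrC mulr_suml; apply: eq_bigr => v vV.
  rewrite {1}/weight_sum (reindex_inj (addrI v)) mulr_sumr /=.
  apply: eq_big => [u|u _]; first by rewrite rpredDl.
  by rewrite addrC chiD -[RHS]mul1r -(cc #|supp v|); ring.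
rewrite exchange_big /= mulr_sumr big_mkcond [RHS]big_mkcond /=.
apply: eq_bigr => u _; rewrite memv_cap.
case: ifP => //= uV; rewrite -mulr_sumr sum_signs.
by case: ifP; rewrite ?mulr0 // mulrC.
Qed.

Lemma weight_sum_conj_trivial : (forall v, v \in bicycle V -> chi v = 1) ->
  weight_sum j * weight_sum (- j) =
  (#|[set v in V]| * #|[set v in bicycle V]|)%:R.
Proof.
move=> chi1; rewrite weight_sum_conj (eq_bigr _ chi1) sumr_const natrM.
by rewrite !cardsE.
Qed.
End Char.

(** * Passage to the quotient by the bicycle space *)

Section Quotient.
Variable K : comNzRingType.

Lemma card_bicycle : #|[set v in bicycle V]| = (2 ^ bicycle_dim V)%N.
Proof. by rewrite cardsE card_vspace card_Fp. Qed.

Lemma dim_bicycle_in : \dim (bicycle_in V) = bicycle_dim V.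
Proof.
rewrite /bicycle_dim -(@limg_dim_eq _ _ _ (linfun (vsval : subvs_of V -> _))).
  rewrite lpreimK //; apply/subvP => v /memv_capP[vV _].
  by apply/memv_imgP; exists (vsproj V v); rewrite ?memvf // lfunE /= vsprojK.
apply/eqP; rewrite -subv0; apply/subvP => v /memv_capP[_].
by rewrite memv_ker memv0 lfunE /= -(inj_eq val_inj).
Qed.

Lemma dim_vquot : \dim {:vquot (bicycle_in V)} = (\dim V - bicycle_dim V)%N.
Proof. by rewrite dimvf -dim_bicycle_in -[dim _]/(\dim _) dimv_compl dimvf. Qed.

(* Each coset of the bicycle space contributes [2 ^ d] equal terms. *)
Lemma weight_sum_quot (j : K) : j ^+ 4 = 1 ->
  (forall x : subvs_of V, vsval x \in bicycle V -> code_form x = 0) ->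
  weight_sum j = 2 ^+ bicycle_dim V *
    \sum_(w : finvect_type (vquot (bicycle_in V))) j ^+ (red_form V w : nat).
Proof.
move=> j4 q0.
pose p (v : GF2 E) : finvect_type (vquot (bicycle_in V)) :=
  vpi (bicycle_in V) (vsproj V v).
rewrite /weight_sum (partition_big p xpredT) //= mulr_sumr.
apply: eq_bigr => w _; rewrite mulrC -natrX -card_bicycle mulr_natr -sumr_const.
(* Adding the representative [b] of the coset [w] carries the bicycle space onto the fibre of [p]
   over [w]. *)
pose b : GF2 E := vsval (repr (w : vquot (bicycle_in V))).
have bV : b \in V by apply: subvsP.
have cosetE (v : GF2 E) :
    (b + v \in V) && (p (b + v) == w) = (v \in [set v in bicycle V]).
  rewrite inE rpredDl // [v \in bicycle V]memv_cap; case: (boolP (v \in V)) => //= vV.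
  rewrite /p -[w in _ == w]vpiK vpi_eq mem_bicycle_in raddfB /= vsprojK;
    last exact: rpredD.
  by rewrite addrAC subrr add0r memv_cap vV.
rewrite (reindex_inj (addrI b)); apply: eq_big => [v|v]; first exact: cosetE.
rewrite cosetE inE => vB; have [vV vP] := memv_capP vB.
have -> : red_form V w = code_form (repr (w : vquot (bicycle_in V)) + vsproj V v).
  rewrite code_formD [code_form (vsproj V v)]q0 ?vsprojK // addr0.
  by rewrite dotC (mem_perp _ _ vP) ?eqxx ?mul0rn ?addr0.
(* The form only retains the weight modulo 4, which is harmless as [j ^+ 4 = 1]. *)
by rewrite /code_form val_Zp_nat // expr_mod // raddfD /= vsprojK.
Qed.
End Quotient.
End Code.

(** * Gaussian integers whose norm is a power of 2 *)

(** The integers are chosen before [K] and [j], so one pair serves both a square root of -1 and its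
    opposite. *)
Lemma exp_gauss_int (I : finType) (f : I -> nat) :
  exists a b : int, forall (K : comNzRingType) (j : K), j ^+ 2 = -1 ->
    \sum_(i : I) j ^+ f i = a%:~R + b%:~R * j.
Proof.
have power n : exists a b : int, forall (K : comNzRingType) (j : K),
    j ^+ 2 = -1 -> j ^+ n = a%:~R + b%:~R * j.
  elim: n => [|n [a [b IH]]]; first by exists 1, 0 => K j _; rewrite expr0 mul0r addr0.
  exists (- b), a => K j j2; rewrite exprS IH // mulrDr mulrCA -expr2 j2.
  by rewrite mulrN1 rmorphN addrC mulrC.
elim: (index_enum I) => [|i s [a [b IH]]].
  by exists 0, 0 => K j _; rewrite big_nil mul0r addr0.
have [c [d Hcd]] := power (f i); exists (c + a), (d + b) => K j j2.
by rewrite big_cons IH // Hcd // !rmorphD /= mulrDl addrACA.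
Qed.

(** Induction on [n]. Norm 1 gives the four units; an even norm forces [a] and [b] to have the same
    parity, so [1 + j] divides [a + b j], and the quotient [c + d j] has half the norm. *)
Lemma gauss_int_norm_pow2 (n : nat) (a b : int) : a ^+ 2 + b ^+ 2 = 2 ^+ n ->
  exists k : nat, forall (K : comNzRingType) (j : K), j ^+ 2 = -1 ->
    a%:~R + b%:~R * j = j ^+ k * (1 + j) ^+ n.
Proof.
elim: n a b => [|n IH] a b ab.
  have : (a = 1 /\ b = 0) \/ (a = 0 /\ b = 1) \/ (a = -1 /\ b = 0) \/ (a = 0 /\ b = -1).
    by have := ab; rewrite expr0 !expr2; nia.
  case=> [[-> ->]|[[-> ->]|[[-> ->]|[-> ->]]]].
  - by exists 0%N => K j _; rewrite mul0r addr0 expr0 mulr1.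
  - by exists 1%N => K j _; rewrite add0r mul1r expr0 mulr1.
  - by exists 2%N => K j ->; rewrite mul0r addr0 mulr1.
  - by exists 3%N => K j j2; rewrite exprS j2 expr0; ring.
have [c [d [? ?]]] : exists c d : int, a = c - d /\ b = c + d.
  have ev : exists c, a + b = 2 * c.
    have : exists m : int, a ^+ 2 + b ^+ 2 = 2 * m by exists (2 ^+ n); rewrite ab exprS.
    case=> m; rewrite !expr2 => e.
    have par (x : int) : exists y : int, x = 2 * y \/ x = 2 * y + 1.
      by exists (x %/ 2)%Z; lia.
    have [a' [] a2] := par a; have [b' [] b2] := par b; subst a b.
    - by exists (a' + b'); lia.
    - by lia.
    - by lia.
    - by exists (a' + b' + 1); lia.
  by case: ev => c e; exists c, (b - c); lia.
subst a b; have cd : c ^+ 2 + d ^+ 2 = 2 ^+ n.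
  by move: ab; rewrite [2 ^+ n.+1]exprS !expr2; set x := 2 ^+ n; lia.
have [k IHk] := IH c d cd; exists k => K j j2.
rewrite exprSr mulrA -IHk // rmorphB rmorphD /=; ring: j2.
Qed.

(** * The primitive eighth root of unity and Brown's invariant *)

Section ComplexExp.
Variable R : realType.
Local Notation C := R[i].

Lemma cexpD (z w : C) : cexp (z + w) = cexp z * cexp w.
Proof.
case: z w => [a b] [c d] /=; rewrite expRD sinD cosD rmorphM /=.
by rewrite mulrACA; congr (_ * _); simpc; congr (_ +i* _); ring.
Qed.

Lemma cexpMn (z : C) (n : nat) : cexp (z * n%:R) = cexp z ^+ n.
Proof.
elim: n => [|n IH]; first by rewrite mulr0 expr0 /= expR0 cos0 sin0 mul1r.
by rewrite mulrS mulrDr mulr1 cexpD IH exprS.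
Qed.

Definition zeta8 : C := cexp (pi%:C * 'i%C / 4).
Local Notation sq2 := ((Num.sqrt 2 : R)%:C).

Lemma sqrt2_neq0 : sq2 != 0.
Proof. by rewrite fmorph_eq0 sqrtr_eq0 -ltNge. Qed.

Lemma sqr_sqrt2C : sq2 ^+ 2 = 2.
Proof. by rewrite -rmorphXn /= sqr_sqrtr // rmorph_nat. Qed.

Lemma sin_pi4 : sin (pi / 4) = cos (pi / 4) :> R.
Proof. by rewrite -cosBpihalf -cosN; congr cos; field. Qed.

Lemma sqrt2_cos_pi4 : Num.sqrt 2 * cos (pi / 4 : R) = 1.
Proof.
have c0 : 0 < cos (pi / 4 : R).
  by apply: cos_gt0_pihalf; have := pi_gt0 R; lra.
have := cos2Dsin2 (pi / 4 : R); rewrite sin_pi4 => c2.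
apply/eqP; rewrite -(@eqrXn2 _ 2) ?mulr_ge0 ?sqrtr_ge0 ?ltW //.
by rewrite exprMn sqr_sqrtr // expr1n; apply/eqP; lra.
Qed.

(** This polar form of [1 + i] turns the factorization of a Gaussian integer into a modulus and a
    phase. *)
Lemma sqrt2_zeta8 : sq2 * zeta8 = 1 + 'i%C.
Proof.
have e : pi%:C * 'i%C / 4 = 0 +i* (pi / 4) :> C.
  rewrite [LHS](_ : _ = (pi / 4)%:C * 'i%C); first by simpc.
  by rewrite rmorphM fmorphV rmorph_nat; ring.
rewrite /zeta8 e /= expR0 mul1r sin_pi4; simpc.
by rewrite sqrt2_cos_pi4.
Qed.

Lemma zeta8_sqr : zeta8 ^+ 2 = 'i%C.
Proof.
have i2 := sqr_i R.
apply: (@mulfI _ (2 : C)); first by rewrite pnatr_eq0.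
by rewrite -[in LHS]sqr_sqrt2C -exprMn sqrt2_zeta8; ring: i2.
Qed.

Lemma zeta8_expr8 : zeta8 ^+ 8 = 1.
Proof. by rewrite (exprM _ 2 4) zeta8_sqr (exprM _ 2 2) sqr_i sqrrN expr1n. Qed.

(** Since [zeta8 ^+ 8 = 1], any natural exponent reduces to one in ['Z_8], so the search in [brown]
    succeeds and its default is never returned. *)
Lemma brownP (W : vectType 'F_2) (q : W -> 'Z_4) :
  (exists n, gauss_sum R q = sq2 ^+ \dim {:W} * zeta8 ^+ n) ->
  gauss_sum R q = sq2 ^+ \dim {:W} * zeta8 ^+ (brown R q : nat).
Proof.
have wE (s : nat) : cexp (pi%:C * 'i%C * s%:R / 4) = zeta8 ^+ s.
  by rewrite -cexpMn; congr cexp; rewrite mulrAC.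
case=> n qn; rewrite /brown; case: pickP => [s /eqP -> /=|/(_ n%:R)].
  by rewrite wE.
by rewrite wE val_Zp_nat // expr_mod ?zeta8_expr8 // qn eqxx.
Qed.

Lemma expi_eq1 (n : nat) : ('i%C : C) ^+ n = 1 -> (4 %| n)%N.
Proof.
have i4 : ('i%C : C) ^+ 4 = 1 by rewrite (exprM _ 2 2) sqr_i sqrrN expr1n.
have n11 : -1 != 1 :> C by rewrite -subr_eq0 -opprD oppr_eq0 -mulr2n pnatr_eq0.
rewrite -(expr_mod _ i4) /dvdn; have : (n %% 4 < 4)%N by rewrite ltn_mod.
case: (n %% 4)%N => [|[|[|[|//]]]] // _ h.
- by case/eqP: n11; rewrite -sqr_i -['i%C]expr1 h expr1n.
- by case/eqP: n11; rewrite -sqr_i h.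
- case/eqP: n11; have := congr1 (fun z => z ^+ 2) h.
  by rewrite -exprM (exprM _ 2 3) sqr_i expr1n exprS sqrrN expr1n mulr1.
Qed.

(** The two sums are [a + b i] and [a - b i] for the same integers, so the hypothesis says that the
    norm is [2 ^ m]. *)
Lemma gauss_sum_octant (W : vectType 'F_2) (q : W -> 'Z_4) (m : nat) :
  (\sum_(x : finvect_type W) 'i%C ^+ (q x : nat))
   * (\sum_(x : finvect_type W) (- 'i%C) ^+ (q x : nat)) = 2 ^+ m :> C ->
  exists n, gauss_sum R q = sq2 ^+ m * zeta8 ^+ n.
Proof.
have i2 := sqr_i R; have ni2 : (- 'i%C) ^+ 2 = -1 :> C by rewrite sqrrN.
have [a [b ab]] := exp_gauss_int (fun x : finvect_type W => q x : nat).
rewrite !ab // => e.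
have /gauss_int_norm_pow2[k abE] : a ^+ 2 + b ^+ 2 = 2 ^+ m.
  apply: (@intr_inj C); rewrite rmorphD !rmorphXn /= -e; ring: i2.
(* Each of the [k] factors [i] is [zeta8 ^+ 2], and each of the [m] factors [1 + i] contributes one
   [zeta8]. *)
exists (2 * k + m)%N; rewrite /gauss_sum ab // abE // -sqrt2_zeta8 exprMn.
by rewrite exprD exprM zeta8_sqr mulrCA.
Qed.
End ComplexExp.

(** * Evaluation at the point [(-i, i)] *)

Theorem theorem4 (R : realType) (E : finType) (V : {vspace GF2 E}) :
  let T := tutte (code_matroid V) (- 'i%C) ('i%C : R[i]) in
  ((forall x : subvs_of V, vsval x \in bicycle V -> code_form x = 0) ->
    T = cexp (pi%:C * 'i%C / 4 *
              ((brown R (red_form V) : nat)%:R + #|E|%:R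
               - 3 * (rank (code_matroid V) [set: E])%:R))
        * (Num.sqrt 2)%:C ^+ bicycle_dim V) /\
  (~ (forall x : subvs_of V, vsval x \in bicycle V -> code_form x = 0) ->
    T = 0).
Proof.
have i2 := sqr_i R.
have inz : 'i%C != 0 :> R[i] by rewrite -sqrf_eq0 i2 oppr_eq0 oner_eq0.
have i4 : ('i%C : R[i]) ^+ 4 = 1 by rewrite (exprM _ 2 2) i2 sqrrN expr1n.
have xy : (- 'i%C - 1) * ('i%C - 1) = 2 :> R[i] by ring: i2.
have x1 : - 'i%C - 1 != 0 :> R[i].
  by apply: contra_eq_neq xy => ->; rewrite mul0r eq_sym pnatr_eq0.
have iV : (- 'i%C)^-1 = 'i%C :> R[i].
  apply: (@mulfI _ (- 'i%C)); rewrite ?oppr_eq0 // divff ?oppr_eq0 //.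
  by rewrite mulNr -expr2 i2 opprK.
rewrite /= (tutte_weight_sum V xy x1) ?oppr_eq0 // iV.
split=> [q0|nq0]; last first.
  rewrite (_ : weight_sum _ _ = 0) ?mulr0 //.
  have [/existsP[v /andP[vB v1]]|/existsPn triv] :=
    boolP [exists v : GF2 E, (v \in bicycle V) && (('i%C : R[i]) ^+ #|supp v| != 1)].
    exact: weight_sum_eq0 vB v1.
  (* If every bicycle word has [i ^ |v| = 1], all these weights are divisible by 4 and the form
     vanishes after all. *)
  case: nq0 => x xB; have := triv (vsval x).
  rewrite xB /= negbK => /eqP /expi_eq1 d4.
  by apply: val_inj; apply/eqP; rewrite /code_form [val _](@val_Zp_nat 4).
have chi1 v : v \in bicycle V -> ('i%C : R[i]) ^+ #|supp v| = 1.
  move=> vB; have [vV _] := memv_capP vB.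
  have := q0 (vsproj V v); rewrite vsprojK // => /(_ vB) /(congr1 val).
  rewrite /code_form vsprojK // [val _](@val_Zp_nat 4) //= => d4.
  by rewrite -(expr_mod _ i4) d4.
have dV : (2 ^ \dim V = 2 ^ (#|E| - rank (code_matroid V) setT))%N.
  by rewrite -card_code cardsE card_vspace card_Fp.
have {}dV : \dim V = (#|E| - rank (code_matroid V) setT)%N.
  by apply/eqP; rewrite -(eqn_exp2l _ _ (isT : 1 < 2)%N) dV.
have := weight_sum_conj_trivial i2 chi1.
have ni4 : (- 'i%C : R[i]) ^+ 4 = 1.
  by rewrite (exprM _ 2 2) sqrrN i2 sqrrN expr1n.
rewrite !weight_sum_quot // card_code -dV card_bicycle.
set G := \sum_w _; set G' := \sum_w _ => GG.
have dB : (bicycle_dim V <= \dim V)%N by rewrite dimvS // capvSl.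
(* [GG] reads [2 ^ (2 d) G G' = |V| |B|], with [d] the bicycle dimension and [|B| = 2 ^ d]. *)
have GG2 : G * G' = 2 ^+ (\dim V - bicycle_dim V).
  apply: (@mulfI _ (2 ^+ (bicycle_dim V + bicycle_dim V))).
    by rewrite expf_neq0 // pnatr_eq0.
  rewrite [in LHS]exprD mulrACA GG natrM !natrX -!exprD; congr (_ ^+ _); lia.
have [n Gn] := gauss_sum_octant GG2.
have Gb := @brownP R _ (red_form V); rewrite dim_vquot in Gb.
have {}Gb := Gb (ex_intro _ n Gn).
rewrite -[G]/(gauss_sum R (red_form V)) Gb.
set s := (brown _ _ : nat); set r := rank _ _; set d := bicycle_dim V.
set sq2 := (Num.sqrt 2)%:C; set w := zeta8 R.
have w8 : w ^+ 8 = 1 := zeta8_expr8 R.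
(* The exponent -3 becomes 5, its residue modulo 8, so that all powers of [w] are natural. *)
have -> : cexp (pi%:C * 'i%C / 4 * (s%:R + #|E|%:R - 3 * r%:R))
    = w ^+ s * w ^+ #|E| * w ^+ (5 * r).
  have wr : w ^+ (3 * r) * w ^+ (5 * r) = 1.
    by rewrite -exprD -mulnDl exprM w8 expr1n.
  apply: etrans (esym (mulr1 _)) _; rewrite -[X in _ * X = _]wr mulrA; congr (_ * _).
  by rewrite /w /zeta8 -!cexpMn -!cexpD natrM; congr cexp; ring.
(* [w ^+ 4 = -1] supplies the sign and [sq2 * w] is [1 + i]. *)
have xw : - 'i%C - 1 = sq2 * w ^+ 5.
  rewrite (exprD _ 4 1) (exprM _ 2 2) zeta8_sqr i2 expr1 mulN1r mulrN sqrt2_zeta8.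
  by ring.
have sq0 : sq2 != 0 := sqrt2_neq0 R.
have xx : - 'i%C / (- 'i%C - 1) = w / sq2.
  apply/eqP; rewrite eqr_div //; apply/eqP.
  have sw : sq2 * w = 1 + w ^+ 2 by rewrite zeta8_sqr; exact: sqrt2_zeta8.
  by rewrite -zeta8_sqr -/w; ring: sw.
have two : 2 ^+ d = sq2 ^+ d * sq2 ^+ d by rewrite -exprMn -expr2 sqr_sqrt2C.
have sn k : sq2 ^+ k != 0 by rewrite expf_neq0.
(* The total exponent of [sq2] is [r - |E| + 2 d + (dim V - d)], which this identity reduces to
   [d]. *)
have Er : #|E| = (r + (\dim V - d) + d)%N.
  have := rank_leq_card (code_matroid V) setT; rewrite cardsT -/r; lia.
rewrite xx xw (exprMn _ sq2 (w ^+ 5)) (exprMn _ w sq2^-1) exprVn two -exprM.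
rewrite [X in sq2 ^- X]Er !exprD; set m := (\dim V - d)%N.
have cancel_powers (K : fieldType) (a b c x y z : K) : a != 0 -> b != 0 -> c != 0 ->
    a * x * (y * (a * b * c)^-1) * (c * c * (b * z)) = z * y * x * c.
  by move=> a0 b0 c0; field; rewrite a0 b0 c0.
exact: cancel_powers.
Qed.
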